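(* The change of objects $\mathcal{D}(C,\Delta_C,\mathrm{d}_C)=(C[[\hbar]],\Delta_C^{\mathrm{d}_C},\mathrm{d}_C)$, where $\Delta_C^{\mathrm{d}_C}=\Delta_C+\mathrm{i}\hbar(\mathrm{d}_C\otimes\mathrm{d}_C)\Delta_C$, together with sending each morphism to its $\mathbb{C}[[\hbar]]$-linear extension, defines a faithful functor $\mathcal{D}:\mathrm{DGCA}\to\mathrm{DGCA}[[\hbar]]$.
   Context: $\mathrm{DGCA}$ is the category whose objects are triples $(C,\Delta_C,\mathrm{d}_C)$ where $C$ is a $\mathbb{Z}$-graded coalgebra over $\mathbb{C}$ with coassociative graded (degree $0$) coproduct $\Delta_C:C\to C\otimes C$, and $\mathrm{d}_C:C\to C$ is a flat coderivation of degree $1$, i.e. a $\mathbb{C}$-linear map of degree $1$ with $\mathrm{d}_C^2=0$ and $\Delta_C\mathrm{d}_C=(\mathrm{id}\otimes\mathrm{d}_C)\Delta_C+(\mathrm{d}_C\otimes\mathrm{id})\Delta_C$. Morphisms $\varphi:C\to D$ are the degree-preserving $\mathbb{C}$-linear maps with $\varphi\,\mathrm{d}_C=\mathrm{d}_D\,\varphi$ and $(\varphi\otimes\varphi)\Delta_C=\Delta_D\varphi$. The formal parameter $\hbar$ has degree $-2$. For a $\mathbb{Z}$-graded vector space $V$, $V[[\hbar]]$ is graded with this convention: its homogeneous elements of degree $k$ are the formal series $\sum_{n\ge0}\hbar^n v_n$ with $v_n\in V$ of degree $k+2n$. $\mathrm{DGCA}[[\hbar]]$ is the corresponding category over $\mathbb{C}[[\hbar]]$: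 objects are $(C[[\hbar]],\Delta,\mathrm{d})$ with $C$ a $\mathbb{Z}$-graded complex vector space, $\Delta:C[[\hbar]]\to(C\otimes C)[[\hbar]]$ a $\mathbb{C}[[\hbar]]$-linear, degree $0$, coassociative coproduct, and $\mathrm{d}:C[[\hbar]]\to C[[\hbar]]$ a $\mathbb{C}[[\hbar]]$-linear degree $1$ coderivation of $\Delta$ with $\mathrm{d}^2=0$; morphisms are the degree-preserving $\mathbb{C}[[\hbar]]$-linear maps $\varphi$ with $\varphi\,\mathrm{d}_C=\mathrm{d}_D\,\varphi$ and $(\varphi\otimes\varphi)\Delta_C=\Delta_D\varphi$. Tensor products of $\mathbb{C}[[\hbar]]$-linear maps are extended to $(C\otimes C)[[\hbar]]$ in the natural $\mathbb{C}[[\hbar]]$-linear way. The Koszul sign convention is used: $(f\otimes g)(v\otimes w)=(-1)^{|g||v|}f(v)\otimes g(w)$. Here $\mathrm{i}=\sqrt{-1}$, and $\Delta_C$, $\mathrm{d}_C$ are extended $\mathbb{C}[[\hbar]]$-linearly to $C[[\hbar]]$. *)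

(* Defs.v *)
From HB Require Import structures.
From mathcomp Require Import all_boot all_order all_algebra.
From mathcomp Require Import finmap.
From mathcomp Require Import boolp functions reals.
From mathcomp Require Import complex.
From mathcomp.multinomials Require Import monalg.
From mathcomp Require Import zify.

Set Implicit Arguments.
Unset Strict Implicit.
Unset Printing Implicit Defensive.

Import GRing.Theory.
Local Open Scope fset_scope.
Local Open Scope ring_scope.
Local Open Scope quotient_scope.

Section TensorProduct.
Variables (K : fieldType) (V W : lmodType K).

Definition free_mod : Type := {malg K[(V * W)%type]}.
HB.instance Definition _ := GRing.Lmodule.on free_mod.

Definition fgen (v : V) (w : W) : free_mod := << (v, w) >>.

Inductive tens_gen : free_mod -> Prop :=
| TensAddl v v' w : tens_gen (fgen (v + v') w - fgen v w - fgen v' w)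
| TensAddr v w w' : tens_gen (fgen v (w + w') - fgen v w - fgen v w')
| TensScalel a v w : tens_gen (fgen (a *: v) w - a *: fgen v w)
| TensScaler a v w : tens_gen (fgen v (a *: w) - a *: fgen v w).

Inductive tens_span : free_mod -> Prop :=
| TensGen z : tens_gen z -> tens_span z
| Tens0 : tens_span 0
| TensLin a x y : tens_span x -> tens_span y -> tens_span (a *: x + y).

Definition tens_rel : {pred free_mod} := fun z => `[< tens_span z >].

Lemma tens_relP z : reflect (tens_span z) (z \in tens_rel).
Proof. exact: asboolP. Qed.

Lemma tens_rel_zmod : zmod_closed tens_rel.
Proof.
split=> [|x y /tens_relP sx /tens_relP sy]; first exact/tens_relP/Tens0.
by apply/tens_relP; rewrite addrC -scaleN1r; exact: TensLin.
Qed.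
HB.instance Definition _ := GRing.isZmodClosed.Build free_mod tens_rel
  tens_rel_zmod.

Definition tens : Type := Quotient.quot tens_rel.
HB.instance Definition _ := GRing.Zmodule.on tens.
HB.instance Definition _ : EqQuotient free_mod _ tens := EqQuotient.on tens.

Let pi (z : free_mod) : tens := \pi_(Quotient.quot tens_rel) z.

Let pi_eq x y : pi x = pi y <-> tens_span (x - y).
Proof.
split; first by move=> /eqP; rewrite -Quotient.idealrBE => /tens_relP.
by move=> /tens_relP; rewrite Quotient.idealrBE => /eqP.
Qed.

Let piD x y : pi (x + y) = pi x + pi y.
Proof. exact: raddfD. Qed.

Let rep (t : tens) : free_mod := repr t.
Let repK t : pi (rep t) = t. Proof. exact: reprK. Qed.

Definition tscale (a : K) (t : tens) : tens := pi (a *: rep t).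

Let piZ a x : pi (a *: x) = tscale a (pi x).
Proof.
apply/pi_eq; rewrite -scalerBr -[_ *: _]addr0.
by apply: TensLin; [apply/pi_eq; rewrite repK | exact: Tens0].
Qed.

Let tscalerA a b t : tscale a (tscale b t) = tscale (a * b) t.
Proof. by rewrite -[t]repK -!piZ scalerA. Qed.
Let tscale1r t : tscale 1 t = t.
Proof. by rewrite -[t]repK -!piZ scale1r. Qed.
Let tscalerDr : right_distributive tscale +%R.
Proof.
by move=> a s t; rewrite -[s]repK -[t]repK -piD -!piZ scalerDr piD.
Qed.
Let tscalerDl t : {morph tscale^~ t : a b / a + b}.
Proof. by move=> a b; rewrite -[t]repK -!piZ scalerDl piD. Qed.

HB.instance Definition _ := GRing.Zmodule_isLmodule.Build K tens
  tscalerA tscale1r tscalerDr tscalerDl.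

(* The quotient of [free_mod] by [tens_span], with the projection and a
   section of it.  It is instantiated opaquely by [tens] so that conversion
   does not unfold the construction: only these properties are used. *)
Record tensor_quotient := TensorQuotient {
  tq_sort : lmodType K;
  tq_pi : free_mod -> tq_sort;
  tq_repr : tq_sort -> free_mod;
  tq_linear : linear tq_pi;
  tq_reprK : cancel tq_repr tq_pi;
  tq_eq : forall x y, tq_pi x = tq_pi y <-> tens_span (x - y)
}.

Definition tensor_quotient_of_tens : tensor_quotient.
Proof.
apply: (@TensorQuotient (tens : lmodType K) pi rep) => //.
by move=> a x y; rewrite piD piZ.
Qed.

Definition tensor : lmodType K := tq_sort tensor_quotient_of_tens.
Definition tpi : free_mod -> tensor := @tq_pi _.
Definition trepr : tensor -> free_mod := @tq_repr _.

Lemma tpi_eq x y : tpi x = tpi y <-> tens_span (x - y).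
Proof. exact: tq_eq. Qed.

Lemma treprK t : tpi (trepr t) = t. Proof. exact: tq_reprK. Qed.

Lemma tpi_linear : linear tpi. Proof. exact: tq_linear. Qed.

Definition tpure (v : V) (w : W) : tensor := tpi (fgen v w).

End TensorProduct.


Notation "v ⊗ w" := (tpure v w) (at level 38, left associativity).

Section TensorLift.
Variables (K : fieldType).
Implicit Types U V W : lmodType K.

Definition bilin V W U (b : V -> W -> U) : Prop :=
  (forall w, linear (b^~ w)) /\ (forall v, linear (b v)).

Lemma linS V W (f g : V -> W) : linear f -> f =1 g -> linear g.
Proof. by move=> lf fg a u v; rewrite -!fg lf. Qed.

Lemma linD V W (f : V -> W) : linear f -> forall u v, f (u + v) = f u + f v.
Proof. by move=> lf u v; rewrite -[u in LHS]scale1r lf scale1r. Qed.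

Lemma lin0 V W (f : V -> W) : linear f -> f 0 = 0.
Proof.
by move=> lf; rewrite -[0 in LHS](addNr 0) -scaleN1r lf scaleN1r addNr.
Qed.

Lemma linZ V W (f : V -> W) : linear f -> forall a v, f (a *: v) = a *: f v.
Proof. by move=> lf a v; rewrite -[_ *: _ in LHS]addr0 lf (lin0 lf) addr0. Qed.

Lemma linN V W (f : V -> W) : linear f -> forall v, f (- v) = - f v.
Proof. by move=> lf v; rewrite -scaleN1r linZ // scaleN1r. Qed.

Lemma linB V W (f : V -> W) : linear f -> forall u v, f (u - v) = f u - f v.
Proof. by move=> lf u v; rewrite (linD lf) (linN lf). Qed.

Lemma lin_sum V W (f : V -> W) I (r : seq I) P (F : I -> V) : linear f ->
  f (\sum_(i <- r | P i) F i) = \sum_(i <- r | P i) f (F i).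
Proof. by move=> lf; apply: (big_morph f (linD lf)); exact: lin0. Qed.

Lemma lin_comp U V W (f : V -> W) (g : U -> V) :
  linear f -> linear g -> linear (f \o g).
Proof. by move=> lf lg a u v /=; rewrite lg lf. Qed.

Lemma sum_lin V W I (r : seq I) P (F : I -> V -> W) :
  (forall i, linear (F i)) -> linear (fun v => \sum_(i <- r | P i) F i v).
Proof.
move=> lF a u v; rewrite scaler_sumr -big_split /=.
by apply: eq_bigr => i _; rewrite lF.
Qed.

Lemma tens_span_lin V W (x y z t : free_mod V W) :
  tens_gen (x - t - z) -> tens_gen (t - y) -> tens_span (x - (y + z)).
Proof.
move=> h1 h2; suff -> : x - (y + z) = 1 *: (x - t - z) + (t - y).
  by apply: TensLin; [exact: TensGen h1 | exact: TensGen h2].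
by rewrite scale1r (addrAC x) subrKA opprD addrA addrAC.
Qed.

Lemma tpure_bilin V W : bilin (@tpure K V W).
Proof.
split=> [w|v] a x y; rewrite /tpure -tpi_linear; apply/tpi_eq.
- apply: (tens_span_lin (t := fgen (a *: x) w)).
    exact: TensAddl.
  exact: TensScalel.
- apply: (tens_span_lin (t := fgen v (a *: x))).
    exact: TensAddr.
  exact: TensScaler.
Qed.

Section Lift.
Variables (V W U : lmodType K) (b : V -> W -> U).

Definition free_lift (z : free_mod V W) : U :=
  \sum_(k <- msupp z) (z@_k) *: b k.1 k.2.

Definition lift0 (t : tensor V W) : U := free_lift (trepr t).

Section Bilinear.
Hypothesis hb : bilin b.

Lemma free_liftw z (d : {fset (V * W)%type}) : (msupp z `<=` d)%fset ->
  free_lift z = \sum_(k <- d) (z@_k) *: b k.1 k.2.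
Proof.
move=> sub; rewrite /free_lift; apply: big_fset_incl => // k _ nk.
by rewrite mcoeff_outdom // scale0r.
Qed.

Lemma free_lift_linear : linear free_lift.
Proof.
move=> a x y.
pose d := (msupp (a *: x + y) `|` (msupp x `|` msupp y))%fset.
rewrite (@free_liftw (a *: x + y) d) ?fsubsetUl //.
rewrite (@free_liftw x d); last first.
  exact: fsubset_trans (fsubsetUl _ _) (fsubsetUr _ _).
rewrite (@free_liftw y d); last first.
  exact: fsubset_trans (fsubsetUr _ _) (fsubsetUr _ _).
rewrite scaler_sumr -big_split /=; apply: eq_bigr => k _.
by rewrite mcoeffD mcoeffZ scalerDl scalerA.
Qed.

Lemma free_lift_gen v w : free_lift (fgen v w) = b v w.
Proof.
rewrite (@free_liftw _ [fset (v, w)]%fset); last exact: msuppU_le.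
by rewrite big_seq_fset1 mcoeffUU scale1r.
Qed.

Lemma free_lift_span z : tens_span z -> free_lift z = 0.
Proof.
elim=> {z}[_ []|| a x y _ hx _ hy]; last 2 first.
- exact: lin0 free_lift_linear.
- by rewrite free_lift_linear hx hy scaler0 addr0.
- move=> v v' w; rewrite !(linB free_lift_linear) !free_lift_gen.
  by rewrite (linD (hb.1 w)) addrAC addrK subrr.
- move=> v w w'; rewrite !(linB free_lift_linear) !free_lift_gen.
  by rewrite (linD (hb.2 v)) addrAC addrK subrr.
- move=> a v w; rewrite (linB free_lift_linear) (linZ free_lift_linear).
  by rewrite !free_lift_gen (linZ (hb.1 w)) subrr.
- move=> a v w; rewrite (linB free_lift_linear) (linZ free_lift_linear).
  by rewrite !free_lift_gen (linZ (hb.2 v)) subrr.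
Qed.

Lemma lift0_pi z : lift0 (tpi z) = free_lift z.
Proof.
apply/eqP; rewrite -subr_eq0 -(linB free_lift_linear).
by apply/eqP/free_lift_span/tpi_eq; rewrite treprK.
Qed.

Lemma lift0_linear : linear lift0.
Proof.
move=> a s t; rewrite -[s]treprK -[t]treprK -tpi_linear !lift0_pi.
exact: free_lift_linear.
Qed.

Lemma lift0E v w : lift0 (v ⊗ w) = b v w.
Proof. by rewrite lift0_pi free_lift_gen. Qed.

End Bilinear.

Lemma tensor_universal : {f : tensor V W -> U |
  bilin b -> linear f /\ forall v w, f (v ⊗ w) = b v w}.
Proof. by exists lift0 => hb; split; [exact: lift0_linear | exact: lift0E]. Qed.

(* The linear map V ⊗ W -> U induced by the bilinear map b. *)
Definition tlift : tensor V W -> U := sval tensor_universal.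

Lemma tlift_linear : bilin b -> linear tlift.
Proof. by case/(svalP tensor_universal). Qed.

Lemma tliftE : bilin b -> forall v w, tlift (v ⊗ w) = b v w.
Proof. by case/(svalP tensor_universal). Qed.

End Lift.

Lemma tensor_ind V W (P : tensor V W -> Prop) :
  P 0 -> (forall a x y, P x -> P y -> P (a *: x + y)) ->
  (forall v w, P (v ⊗ w)) -> forall t, P t.
Proof.
move=> P0 PL Pp t; rewrite -[t]treprK; set z : free_mod _ _ := trepr t.
have -> : z = \sum_(k <- msupp z) (z@_k) *: fgen k.1 k.2.
  rewrite {1}(monalgE z : z = _); apply: eq_bigr => -[v w] _.
  apply/malgP => k; rewrite mcoeffZ !mcoeffU /=.
  by case: eqP => _; rewrite ?mulr1 ?mulr0.
elim: (msupp z : seq _) => [|k s IH].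
  by rewrite big_nil (lin0 (@tpi_linear K V W)).
rewrite big_cons tpi_linear.
exact: (PL _ _ _ (Pp k.1 k.2) IH).
Qed.

Lemma tens_ext V W U (f g : tensor V W -> U) : linear f -> linear g ->
  (forall v w, f (v ⊗ w) = g (v ⊗ w)) -> f =1 g.
Proof.
move=> lf lg fg; apply: tensor_ind => //; first by rewrite !lin0.
by move=> a x y fx fy; rewrite lf lg fx fy.
Qed.

(* (f ⊗ g)(v ⊗ w) = f v ⊗ g w, without sign. *)
Definition tmap V W V' W' (f : V -> V') (g : W -> W') :
  tensor V W -> tensor V' W' := tlift (fun v w => f v ⊗ g w).

Lemma tmap_bilin V W V' W' (f : V -> V') (g : W -> W') :
  linear f -> linear g -> bilin (fun v w => f v ⊗ g w).
Proof.
move=> lf lg; split=> [w|v] a x y.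
  by rewrite lf (tpure_bilin V' W').1.
by rewrite lg (tpure_bilin V' W').2.
Qed.

Lemma tmap_linear V W V' W' (f : V -> V') (g : W -> W') :
  linear f -> linear g -> linear (tmap f g).
Proof. by move=> lf lg; apply: tlift_linear; exact: tmap_bilin. Qed.

Lemma tmapE V W V' W' (f : V -> V') (g : W -> W') : linear f -> linear g ->
  forall v w, tmap f g (v ⊗ w) = f v ⊗ g w.
Proof. by move=> lf lg v w; rewrite /tmap tliftE //; exact: tmap_bilin. Qed.

Definition tassoc_r U V W (w : W) : tensor U V -> tensor U (tensor V W) :=
  tlift (fun u v => u ⊗ (v ⊗ w)).

Definition tassoc U V W : tensor (tensor U V) W -> tensor U (tensor V W) :=
  tlift (fun t w => tassoc_r w t).

Lemma tassoc_r_bilin U V W (w : W) :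
  bilin (fun (u : U) (v : V) => u ⊗ (v ⊗ w)).
Proof.
split=> [v|u] a x y; first exact: (tpure_bilin _ _).1.
by rewrite (tpure_bilin _ _).1 (tpure_bilin _ _).2.
Qed.

Lemma tassoc_bilin U V W :
  bilin (fun (t : tensor U V) (w : W) => tassoc_r w t).
Proof.
split=> [w|t] a x y; first exact: (tlift_linear (tassoc_r_bilin _ _ w)).
pose F w s := @tassoc_r U V W w s.
have lF w : linear (F w) := tlift_linear (tassoc_r_bilin _ _ w).
suff /(_ t) : F (a *: x + y) =1 (fun s => a *: F x s + F y s) by [].
apply: tens_ext => [||u v]; [exact: lF| |].
  move=> c s s'; rewrite !lF !scalerDr !scalerA (mulrC a c).
  by rewrite addrACA.
have FE w : F w (u ⊗ v) = u ⊗ (v ⊗ w) := tliftE (tassoc_r_bilin _ _ w) u v.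
by rewrite !FE ((tpure_bilin V W).2 v a) ((tpure_bilin U _).2 u a).
Qed.

Lemma tassoc_linear U V W : linear (@tassoc U V W).
Proof. exact: tlift_linear (@tassoc_bilin U V W). Qed.

Lemma tassocE U V W (u : U) (v : V) (w : W) :
  tassoc (u ⊗ v ⊗ w) = u ⊗ (v ⊗ w).
Proof.
rewrite /tassoc (tliftE (tassoc_bilin U V W)).
exact: tliftE (tassoc_r_bilin U V w) u v.
Qed.

End TensorLift.
Section Graded.
Variable K : fieldType.

(* A Z-graded vector space V = ⊕_k V_k, the decomposition being given by the
   projections gv_proj k : V -> V onto the summands V_k. *)
Record gradedVect := GradedVect {
  gv_sort :> lmodType K;
  gv_proj : int -> gv_sort -> gv_sort;
  gv_proj_linear : forall k, linear (gv_proj k);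
  gv_proj_orth : forall j k v,
    gv_proj j (gv_proj k v) = if j == k then gv_proj k v else 0;
  gv_proj_sum : forall v, exists s : seq int,
    uniq s /\ v = \sum_(k <- s) gv_proj k v
}.
Implicit Types V W : gradedVect.

Definition homog V (k : int) (v : V) : Prop := gv_proj k v = v.

Lemma homog_proj V k (v : V) : homog k (gv_proj k v).
Proof. by rewrite /homog gv_proj_orth eqxx. Qed.

Lemma homog_proj_neq V j k (v : V) : homog k v -> j != k -> gv_proj j v = 0.
Proof. by move=> <- /negPf jk; rewrite gv_proj_orth jk. Qed.

Lemma homog0 V k : homog k (0 : V).
Proof. exact: lin0 (gv_proj_linear k). Qed.

Lemma homogL V k a (u v : V) : homog k u -> homog k v -> homog k (a *: u + v).
Proof. by move=> hu hv; rewrite /homog gv_proj_linear hu hv. Qed.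

Lemma homogD V k (u v : V) : homog k u -> homog k v -> homog k (u + v).
Proof. by move=> hu hv; rewrite -[u]scale1r; exact: homogL. Qed.

Lemma homogZ V k a (v : V) : homog k v -> homog k (a *: v).
Proof. by move=> hv; rewrite -[_ *: _]addr0; apply: homogL => //; exact: homog0. Qed.

Lemma homog_sum V k I (r : seq I) P (F : I -> V) :
  (forall i, homog k (F i)) -> homog k (\sum_(i <- r | P i) F i).
Proof.
by move=> hF; apply: big_ind => //; [exact: homog0 | exact: homogD].
Qed.

Lemma homog_ext V (U : lmodType K) (f g : V -> U) : linear f -> linear g ->
  (forall k v, homog k v -> f v = g v) -> f =1 g.
Proof.
move=> lf lg fg v; have [s [_ ->]] := gv_proj_sum v.
rewrite !lin_sum //; apply: eq_bigr => k _; exact/fg/homog_proj.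
Qed.

Section DirectSum.
Variables (V : gradedVect) (U : lmodType K) (c : int -> V -> U).

Lemma sum_superset (s t : seq int) (F : int -> U) :
  uniq s -> uniq t -> {subset s <= t} -> (forall k, k \notin s -> F k = 0) ->
  \sum_(k <- t) F k = \sum_(k <- s) F k.
Proof.
move=> us ut st F0; rewrite (bigID (mem s)) /= [X in _ + X]big1 ?addr0 //.
rewrite -big_filter; apply: perm_big; apply: uniq_perm => //.
  exact: filter_uniq.
by move=> k; rewrite mem_filter; case: (boolP (k \in s)) => //= /st.
Qed.

Lemma proj_notin (s : seq int) (v : V) k :
  v = \sum_(k <- s) gv_proj k v -> k \notin s -> gv_proj k v = 0.
Proof.
move=> -> ks; rewrite (lin_sum _ _ _ (gv_proj_linear k)).
rewrite big_seq big1 // => j js; rewrite gv_proj_orth.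
by case: eqP ks js => // -> /negPf ->.
Qed.

Lemma graded_universal : {f : V -> U | (forall k, linear (c k)) ->
  linear f /\ forall k v, homog k v -> f v = c k v}.
Proof.
pose S (v : V) := sval (cid (gv_proj_sum v)).
have uS v : uniq (S v) by rewrite /S; case: cid => s [].
have SE v : v = \sum_(k <- S v) gv_proj k v by rewrite /S; case: cid => s [].
pose f (v : V) := \sum_(k <- S v) c k (gv_proj k v).
exists f => lc.
have fE v s : uniq s -> v = \sum_(k <- s) gv_proj k v ->
    forall t, uniq t -> {subset s <= t} ->
    f v = \sum_(k <- t) c k (gv_proj k v).
  move=> us vs t ut st; pose r := undup (S v ++ t).
  have E (q : seq int) : uniq q -> v = \sum_(k <- q) gv_proj k v ->
      {subset q <= r} ->
      \sum_(k <- r) c k (gv_proj k v) = \sum_(k <- q) c k (gv_proj k v).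
    move=> uq vq qr; apply: sum_superset => //; first exact: undup_uniq.
    by move=> k kq; rewrite (proj_notin vq kq) (lin0 (lc k)).
  have sr : {subset s <= r}.
    by move=> k /st kt; rewrite mem_undup mem_cat kt orbT.
  have Sr : {subset S v <= r}.
    by move=> k kS; rewrite mem_undup mem_cat kS.
  rewrite /f -(E (S v)) // (E s) //; apply/esym; apply: sum_superset => //.
  by move=> k ks; rewrite (proj_notin vs ks) (lin0 (lc k)).
split=> [a u v | k v kv]; last first.
  rewrite (fE v [:: k] _ _ [:: k]) ?big_seq1 ?kv //.
pose t := undup (S (a *: u + v) ++ S u ++ S v).
have ut : uniq t by exact: undup_uniq.
rewrite (fE _ _ (uS (a *: u + v)) (SE _) t) //; last first.
  by move=> k kS; rewrite mem_undup !mem_cat kS.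
rewrite (fE _ _ (uS u) (SE _) t) //; last first.
  by move=> k kS; rewrite mem_undup !mem_cat kS orbT.
rewrite (fE _ _ (uS v) (SE _) t) //; last first.
  by move=> k kS; rewrite mem_undup !mem_cat kS !orbT.
rewrite scaler_sumr -big_split /=; apply: eq_bigr => k _.
by rewrite gv_proj_linear lc.
Qed.

(* The linear map on V = ⊕_k V_k that restricts to c k on V_k. *)
Definition glue : V -> U := sval graded_universal.

Lemma glue_linear : (forall k, linear (c k)) -> linear glue.
Proof. by case/(svalP graded_universal). Qed.

Lemma glueE : (forall k, linear (c k)) ->
  forall k v, homog k v -> glue v = c k v.
Proof. by case/(svalP graded_universal). Qed.

End DirectSum.

Section GradedTensor.
Variables V W : gradedVect.

(* For v of degree p: v ⊗ w |-> v ⊗ (component of w of degree n - p). *)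
Definition tproj (n : int) : tensor V W -> tensor V W :=
  tlift (fun (v : V) (w : W) =>
    glue (fun p (x : V) => x ⊗ (gv_proj (n - p) w : W)) v).

Let lin1 n (w : W) p : linear (fun x : V => x ⊗ (gv_proj (n - p) w : W)).
Proof. exact: (tpure_bilin V W).1. Qed.

Lemma tproj_bilin n : bilin (fun (v : V) (w : W) =>
    glue (fun p (x : V) => x ⊗ (gv_proj (n - p) w : W)) v).
Proof.
split=> [w|v] a x y; first exact: (glue_linear (lin1 n w)).
move: v; apply: homog_ext => [||k v kv].
- exact: (glue_linear (lin1 n _)).
- move=> b u v; rewrite !(glue_linear (lin1 n _)).
  by rewrite !scalerDr !scalerA (mulrC a b) addrACA.
- rewrite !(glueE (lin1 n _) kv) gv_proj_linear.
  exact: (tpure_bilin V W).2.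
Qed.

Lemma tproj_linear n : linear (tproj n).
Proof. exact: tlift_linear (tproj_bilin n). Qed.

Lemma tprojE n p q (v : V) (w : W) : homog p v -> homog q w ->
  tproj n (v ⊗ w) = if n == p + q then v ⊗ w else 0.
Proof.
move=> hv hw; rewrite /tproj (tliftE (tproj_bilin n)) (glueE (lin1 n w) hv).
case: eqP => [->|/eqP npq]; first by rewrite (addrC p) addrK hw.
rewrite (homog_proj_neq hw) ?(lin0 ((tpure_bilin V W).2 v)) //.
by apply: contra npq => /eqP <-; rewrite addrC subrK.
Qed.

Lemma tensor_homog_ext (U : lmodType K) (f g : tensor V W -> U) :
  linear f -> linear g ->
  (forall p q (v : V) (w : W), homog p v -> homog q w ->
    f (v ⊗ w) = g (v ⊗ w)) -> f =1 g.
Proof.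
move=> lf lg fg; apply: tens_ext => // v w.
have [tl tr] := tpure_bilin V W.
move: v; apply: (homog_ext (f := fun v => f (v ⊗ w))
                            (g := fun v => g (v ⊗ w))) => [||p v hv].
- exact: lin_comp lf (tl w).
- exact: lin_comp lg (tl w).
move: w; apply: (homog_ext (f := fun w => f (v ⊗ w))
                            (g := fun w => g (v ⊗ w))) => [||q w hw].
- exact: lin_comp lf (tr v).
- exact: lin_comp lg (tr v).
exact: fg hv hw.
Qed.

Lemma tproj_orth j k t :
  tproj j (tproj k t) = if j == k then tproj k t else 0.
Proof.
have lj := tproj_linear j; have lk := tproj_linear k.
move: t; apply: (tensor_homog_ext (f := tproj j \o tproj k)).
- exact: lin_comp.
- by case: eqP => // _ a u v; rewrite scaler0 addr0.
move=> p q v w hv hw /=; rewrite (tprojE k hv hw).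
case: (k =P p + q) => [->|_]; last by rewrite (lin0 lj); case: ifP.
by rewrite (tprojE j hv hw).
Qed.

Lemma tproj_sum t : exists s : seq int,
  uniq s /\ t = \sum_(k <- s) tproj k t.
Proof.
pose D t := exists s : seq int, t = \sum_(k <- s) tproj k t.
have D_uniq u : D u -> forall r, (forall k, tproj k u != 0 -> k \in r) ->
    uniq r -> u = \sum_(k <- r) tproj k u.
  move=> [s us] r sr ur; rewrite {1}us.
  pose N := \sum_(k <- s) tproj k u.
  have -> : \sum_(k <- r) tproj k u = \sum_(k <- r) tproj k N.
    by rewrite /N -us.
  rewrite /N; under [RHS]eq_bigr do rewrite (lin_sum _ _ _ (tproj_linear _)).
  rewrite exchange_big /=; apply: eq_bigr => k _.
  case: (eqVneq (tproj k u) 0) => [E|kn].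
    by rewrite E big1 // => i _; rewrite (lin0 (tproj_linear i)).
  rewrite (bigD1_seq k) //= ?sr // tproj_orth eqxx big1 ?addr0 // => i ik.
  by rewrite tproj_orth (negPf ik).
have D_supp u : D u -> exists s : seq int, forall k, tproj k u != 0 -> k \in s.
  move=> [s us]; exists s => k; apply: contraNT => ks.
  rewrite us (lin_sum _ _ _ (tproj_linear k)) big_seq big1 // => j js.
  by rewrite tproj_orth; case: eqP ks js => // -> /negPf ->.
have DL a u v : D u -> D v -> D (a *: u + v).
  move=> Du Dv; have [s hs] := D_supp _ Du; have [r hr] := D_supp _ Dv.
  pose q := undup (s ++ r); exists q.
  rewrite {1}(D_uniq _ Du q) ?undup_uniq //; last first.
    by move=> k /hs ks; rewrite mem_undup mem_cat ks.
  rewrite {1}(D_uniq _ Dv q) ?undup_uniq //; last first.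
    by move=> k /hr kr; rewrite mem_undup mem_cat kr orbT.
  rewrite scaler_sumr -big_split; apply: eq_bigr => k _ /=.
  by rewrite (tproj_linear k).
have D0 : D 0 by exists [::]; rewrite big_nil.
have Dsum I (r : seq I) (F : I -> tensor V W) :
    (forall i, D (F i)) -> D (\sum_(i <- r) F i).
  move=> DF; elim: r => [|i r IH]; first by rewrite big_nil.
  by rewrite big_cons -[F i]scale1r; exact: DL.
have Dt : forall t, D t.
  apply: tensor_ind => // v w; have [tl tr] := tpure_bilin V W.
  have [s [_ ->]] := gv_proj_sum v; have [r [_ ->]] := gv_proj_sum w.
  rewrite (lin_sum _ _ _ (tl _)); apply: (Dsum) => p.
  rewrite (lin_sum _ _ _ (tr _)); apply: (Dsum) => q.
  exists [:: p + q]; rewrite big_seq1.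
  by rewrite (tprojE _ (homog_proj _ _) (homog_proj _ _)) eqxx.
have [s hs] := D_supp t (Dt t); exists (undup s); rewrite undup_uniq.
by split=> //; apply: D_uniq; rewrite ?undup_uniq // => k /hs; rewrite mem_undup.
Qed.

Definition gtensor : gradedVect :=
  GradedVect tproj_linear tproj_orth tproj_sum.

Lemma tpure_homog p q (v : V) (w : W) : homog p v -> homog q w ->
  @homog gtensor (p + q) (v ⊗ w).
Proof. by move=> hv hw; rewrite /homog /= (tprojE _ hv hw) eqxx. Qed.

End GradedTensor.

Implicit Types d e : int.

(* Linear maps V -> W of degree d. *)
Record ghom d V W := GHom {
  ghom_fun :> V -> W;
  ghom_linear : linear ghom_fun;
  ghom_homog : forall k v, homog k v -> homog (k + d) (ghom_fun v)
}.

Lemma ghomP d V W (f g : ghom d V W) : f =1 g -> f = g.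
Proof.
case: f g => [f lf hf] [g lg hg] /= /funext fg; rewrite {}fg in lf hf *.
by congr GHom; exact: Prop_irrelevance.
Qed.

Lemma gid_homog V k (v : V) : homog k v -> homog (k + 0) (id v).
Proof. by rewrite addr0. Qed.

Lemma gid_linear V : linear (@id V). Proof. by []. Qed.

Definition gid V : ghom 0 V V := GHom (@gid_linear V) (@gid_homog V).

Section Comp.
Variables (U V W : gradedVect) (g : ghom 0 V W) (f : ghom 0 U V).

Lemma gcomp_homog k (u : U) : homog k u -> homog (k + 0) ((g \o f) u).
Proof. by move=> /(ghom_homog f)/(ghom_homog g); rewrite !addr0. Qed.

Definition gcomp : ghom 0 U W :=
  GHom (lin_comp (ghom_linear g) (ghom_linear f)) gcomp_homog.

End Comp.

(* gsign e v = (-1)^(e |v|) v for v homogeneous. *)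
Definition gsign e V : V -> V := glue (fun p (v : V) => (-1) ^ (e * p) *: v).

Lemma scale_linear (V : lmodType K) (a : K) : linear (fun v : V => a *: v).
Proof. by move=> b u v; rewrite scalerDr !scalerA mulrC. Qed.

Lemma gsign_linear e V : linear (@gsign e V).
Proof. by apply: glue_linear => p; exact: scale_linear. Qed.

Lemma gsignE e V p (v : V) : homog p v -> gsign e v = (-1) ^ (e * p) *: v.
Proof. by apply: glueE => q; exact: scale_linear. Qed.

Section KoszulTensor.
Variables (d e : int) (V W V' W' : gradedVect).
Variables (f : ghom d V V') (g : ghom e W W').

Let lfs : linear (f \o @gsign e V).
Proof. exact: lin_comp (ghom_linear f) (@gsign_linear e V). Qed.

Lemma ktens_linear :
  linear (tmap (f \o @gsign e V) g : gtensor V W -> gtensor V' W').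
Proof. exact: tmap_linear lfs (ghom_linear g). Qed.

Lemma ktens_pure p (v : V) (w : W) : homog p v ->
  tmap (f \o @gsign e V) g (v ⊗ w) = (-1) ^ (e * p) *: (f v ⊗ g w).
Proof.
move=> hv; rewrite (tmapE lfs (ghom_linear g)) /= (gsignE _ hv).
by rewrite (linZ (ghom_linear f)) (linZ ((tpure_bilin _ _).1 _)).
Qed.

Lemma ktens_homog k (t : gtensor V W) : homog k t ->
  @homog (gtensor V' W') (k + (d + e)) (tmap (f \o @gsign e V) g t).
Proof.
move=> <-; rewrite /=.
pose F : tensor V W -> tensor V' W' := tmap (f \o @gsign e V) g.
pose P := @tproj V' W' (k + (d + e)).
have lF : linear F := ktens_linear.
have lP : linear P := @tproj_linear _ _ _.
have lT := @tproj_linear V W k.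
apply: (@tensor_homog_ext V W _ (P \o F \o tproj k) (F \o tproj k)).
- exact: lin_comp (lin_comp lP lF) lT.
- exact: lin_comp lF lT.
move=> p q v w hv hw /=; rewrite (tprojE k hv hw).
case: eqP => [kpq|_]; last by rewrite (lin0 lF) (lin0 lP).
rewrite /F (ktens_pure w hv) (linZ lP); congr (_ *: _).
rewrite /P (tprojE _ (ghom_homog f hv) (ghom_homog g hw)).
by rewrite addrACA -kpq eqxx.
Qed.

(* The tensor product with Koszul signs:
   (f ⊗ g)(v ⊗ w) = (-1)^(|g| |v|) f v ⊗ g w. *)
Definition gtens : ghom (d + e) (gtensor V W) (gtensor V' W') :=
  GHom ktens_linear ktens_homog.

Lemma gtensE p (v : V) (w : W) : homog p v ->
  gtens (v ⊗ w) = (-1) ^ (e * p) *: (f v ⊗ g w).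
Proof. exact: ktens_pure. Qed.

End KoszulTensor.

Record dgca_data := DGCAData {
  dg_space :> gradedVect;
  dg_coprod : ghom 0 dg_space (gtensor dg_space dg_space);
  dg_diff : ghom 1 dg_space dg_space
}.

Record is_dgca (C : dgca_data) : Prop := IsDGCA {
  dg_coassoc : forall c : C,
    tassoc (gtens (dg_coprod C) (gid C) (dg_coprod C c)) =
    gtens (gid C) (dg_coprod C) (dg_coprod C c);
  dg_flat : forall c : C, dg_diff C (dg_diff C c) = 0;
  dg_coder : forall c : C,
    dg_coprod C (dg_diff C c) =
    gtens (gid C) (dg_diff C) (dg_coprod C c) +
    gtens (dg_diff C) (gid C) (dg_coprod C c)
}.

Record is_dgca_hom (C D : dgca_data) (phi : ghom 0 C D) : Prop := IsDGCAHom {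
  dg_hom_diff : forall c : C, phi (dg_diff C c) = dg_diff D (phi c);
  dg_hom_coprod : forall c : C,
    gtens phi phi (dg_coprod C c) = dg_coprod D (phi c)
}.

Record dgca := DGCAOb { dgca_val :> dgca_data; dgca_law : is_dgca dgca_val }.

Record dgca_hom (C D : dgca) := DGCAHom {
  dgca_hom_val :> ghom 0 C D;
  dgca_hom_law : is_dgca_hom dgca_hom_val
}.

Lemma dgca_homP (C D : dgca) (f g : dgca_hom C D) : f =1 g -> f = g.
Proof.
case: f g => [f hf] [g hg] /= /ghomP fg; rewrite {}fg in hf *.
by congr DGCAHom; exact: Prop_irrelevance.
Qed.

Lemma gtens_id V W : gtens (gid V) (gid W) =1 id.
Proof.
apply: (tensor_homog_ext (ghom_linear (gtens (gid V) (gid W)))) => //.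
by move=> p q v w hv hw; rewrite (gtensE _ _ w hv) mul0r expr0z scale1r.
Qed.

Lemma gtens_comp U V W U' V' W' (g : ghom 0 V W) (g' : ghom 0 V' W')
    (f : ghom 0 U V) (f' : ghom 0 U' V') (t : gtensor U U') :
  gtens (gcomp g f) (gcomp g' f') t = gtens g g' (gtens f f' t).
Proof.
move: t; apply: (tensor_homog_ext (f := gtens (gcomp g f) (gcomp g' f'))
                                  (g := gtens g g' \o gtens f f')).
- exact: ghom_linear (gtens (gcomp g f) (gcomp g' f')).
- exact: lin_comp (ghom_linear (gtens g g')) (ghom_linear (gtens f f')).
move=> p q v w hv hw; rewrite -[RHS]/(gtens g g' (gtens f f' (v ⊗ w))).
rewrite !(gtensE _ _ _ hv) !mul0r !expr0z !scale1r.
by rewrite (gtensE _ _ _ (ghom_homog f hv)) mul0r expr0z scale1r.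
Qed.

Lemma dgca_id_law (C : dgca) : is_dgca_hom (gid C).
Proof. by split=> c //=; exact: gtens_id. Qed.

Lemma dgca_comp_law (B C D : dgca) (g : dgca_hom C D) (f : dgca_hom B C) :
  is_dgca_hom (gcomp g f).
Proof.
case: g f => [g [gd gc]] [f [fd fc]]; split=> c; first by rewrite /= fd gd.
by rewrite gtens_comp fc gc.
Qed.

Definition dgca_id C : dgca_hom C C := DGCAHom (dgca_id_law C).
Definition dgca_comp B C D (g : dgca_hom C D) (f : dgca_hom B C) :
  dgca_hom B D := DGCAHom (dgca_comp_law g f).

(* V[[h]], where h stands for the formal parameter of degree -2; the series u
   stands for Σ_n h^n u_n. *)
Definition fps (V : Type) := nat -> V.
HB.instance Definition _ (V : lmodType K) := GRing.Lmodule.copy (fps V) (nat -> V).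

Lemma fpsDE (V : lmodType K) (u v : fps V) n : (u + v) n = u n + v n.
Proof. by []. Qed.

Lemma fpsZE (V : lmodType K) a (u : fps V) n : (a *: u) n = a *: u n.
Proof. by []. Qed.

(* The action of K[[h]] on V[[h]]. *)
Definition hscale (V : lmodType K) (a : fps K) (u : fps V) : fps V :=
  fun n => \sum_(i < n.+1) a i *: u (n - i)%N.

Definition hhomog V (k : int) (u : fps V) : Prop :=
  forall n, homog (k + (2 * n)%:Z) (u n).

(* K[[h]]-linear maps V[[h]] -> W[[h]] of degree d; [hhom_scale] at constant
   series gives K-linearity. *)
Record hhom d V W := HHom {
  hhom_fun :> fps V -> fps W;
  hhom_add : forall u v, hhom_fun (u + v) = hhom_fun u + hhom_fun v;
  hhom_scale : forall a u, hhom_fun (hscale a u) = hscale a (hhom_fun u);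
  hhom_homog : forall k u, hhomog k u -> hhomog (k + d) (hhom_fun u)
}.

Lemma hhomP d V W (F G : hhom d V W) : F =1 G -> F = G.
Proof.
case: F G => [f af sf hf] [g ag sg hg] /= /funext fg.
rewrite {}fg in af sf hf *.
by congr HHom; exact: Prop_irrelevance.
Qed.

Definition hid V : hhom 0 V V.
Proof. by exists id => // k u; rewrite addr0. Defined.

Definition hcomp U V W (G : hhom 0 V W) (F : hhom 0 U V) : hhom 0 U W.
Proof.
exists (G \o F) => [u v|a u|k u hu] /=; first by rewrite !hhom_add.
  by rewrite !hhom_scale.
by rewrite -[k]addr0; apply: hhom_homog; exact: hhom_homog.
Defined.

Section TriangularSums.
Variable M : nmodType.

Lemma tri_sum (F : nat -> nat -> nat -> M) n :
  \sum_(a < n.+1) \sum_(i < a.+1) F i (a - i)%N (n - a)%N =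
  \sum_(i < n.+1) \sum_(j < (n - i).+1) F i j (n - i - j)%N.
Proof.
transitivity (\sum_(0 <= a < n.+1) \sum_(0 <= i < n.+1 | (i <= a)%N)
                F i (a - i)%N (n - a)%N).
  rewrite big_mkord; apply: eq_bigr => a _.
  rewrite [RHS](big_cat_nat (n := a.+1)) //= [X in _ + X]big_nat_cond.
  rewrite [X in _ + X]big1 ?addr0; last first.
    by move=> i /andP[/andP[ai _] ia]; move: (leq_ltn_trans ia ai); rewrite ltnn.
  rewrite -(big_mkord xpredT (fun i => F i (a - i)%N (n - a)%N)).
  rewrite big_nat_cond [RHS]big_nat_cond; apply: eq_bigl => i.
  by rewrite andbT; case: (ltnP i a.+1); rewrite ?andbF ?andbT // ltnS => ->.
rewrite (exchange_big_dep xpredT) //= big_mkord; apply: eq_bigr => i _.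
have lin : (i <= n)%N by rewrite -ltnS.
rewrite (big_cat_nat (n := i)) //=; last exact: ltnW.
rewrite big_nat_cond big1 ?add0r; last first.
  by move=> a /andP[/andP[_ ai] ia]; move: (leq_ltn_trans ia ai); rewrite ltnn.
rewrite -[X in \sum_(X <= _ < _ | _) _]add0n big_addn subSn // big_mkord.
apply: eq_big => [j|j _]; first by rewrite leq_addl.
by rewrite addnK addnC subnDA.
Qed.

Lemma swap_sum (G : nat -> nat -> nat -> M) n :
  \sum_(i < n.+1) \sum_(j < (n - i).+1) G i j (n - i - j)%N =
  \sum_(i < n.+1) \sum_(j < (n - i).+1) G j i (n - i - j)%N.
Proof.
rewrite -tri_sum -(tri_sum (fun i j => G j i)); apply: eq_bigr => a _.
rewrite (reindex_inj rev_ord_inj) /=; apply: eq_bigr => i _.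
by rewrite subSS subKn // -ltnS.
Qed.

Lemma swap4_sum (H : nat -> nat -> nat -> nat -> M) n :
  \sum_(a < n.+1) \sum_(i < a.+1) \sum_(k < (n - a).+1)
    H i (a - i)%N k (n - a - k)%N =
  \sum_(b < n.+1) \sum_(i < b.+1) \sum_(j < (n - b).+1)
    H i j (b - i)%N (n - b - j)%N.
Proof.
rewrite (tri_sum (fun i j m => \sum_(k < m.+1) H i j k (m - k)%N)).
rewrite (tri_sum (fun i k m => \sum_(j < m.+1) H i j k (m - j)%N)).
by apply: eq_bigr => i _; rewrite (swap_sum (H i)).
Qed.

End TriangularSums.

Section Extension.
Variables (V W : lmodType K).
Implicit Type T : nat -> V -> W.

(* The K[[h]]-linear extension of the map v |-> Σ_n h^n T_n v. *)
Definition hext T (u : fps V) : fps W :=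
  fun n => \sum_(i < n.+1) T i (u (n - i)%N).

Lemma hext_add T : (forall n, linear (T n)) ->
  forall u v, hext T (u + v) = hext T u + hext T v.
Proof.
move=> lT u v; apply/funext => n; rewrite fpsDE -big_split /=.
by apply: eq_bigr => i _; rewrite -(linD (lT i)).
Qed.

Lemma hext_scale T : (forall n, linear (T n)) ->
  forall a u, hext T (hscale a u) = hscale a (hext T u).
Proof.
move=> lT a u; apply/funext => n; rewrite /hext /hscale.
under eq_bigr do rewrite (lin_sum _ _ _ (lT _)).
rewrite (swap_sum (fun i j m => T i (a j *: u m))).
apply: eq_bigr => i _; rewrite scaler_sumr; apply: eq_bigr => j _.
by rewrite (linZ (lT j)).
Qed.

End Extension.

Lemma hext_homog d V W (T : nat -> V -> W) :
  (forall n k v, homog k v -> homog (k + (d + (2 * n)%:Z)) (T n v)) ->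
  forall k u, hhomog k u -> hhomog (k + d) (hext T u).
Proof.
move=> hT k u hu n; apply: homog_sum => i.
have -> : k + d + (2 * n)%:Z =
    k + (2 * (n - i))%:Z + (d + (2 * i)%:Z) by case: i => i /=; lia.
exact: hT.
Qed.

(* The K[[h]]-linear extension of a map V -> W. *)
Section Lift.
Variables (d : int) (V W : gradedVect) (f : ghom d V W).

Let lift (u : fps V) : fps W := fun n => f (u n).

Let lift_add u v : lift (u + v) = lift u + lift v.
Proof. by apply/funext => n; exact: linD (ghom_linear f) _ _. Qed.

Let lift_scale a u : lift (hscale a u) = hscale a (lift u).
Proof.
apply/funext => n; rewrite /lift (lin_sum _ _ _ (ghom_linear f)).
by apply: eq_bigr => i _; rewrite (linZ (ghom_linear f)).
Qed.

Let lift_homog k u : hhomog k u -> hhomog (k + d) (lift u).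
Proof. by move=> hu n; rewrite addrAC; exact: ghom_homog. Qed.

Definition hlift : hhom d V W := HHom lift_add lift_scale lift_homog.

End Lift.

Definition fpsC (V : lmodType K) (v : V) : fps V :=
  fun n => if n is 0%N then v else 0.

Lemma fpsC_homog V k (v : V) : homog k v -> hhomog k (fpsC v).
Proof. by move=> hv [|n] /=; [rewrite addr0 | exact: homog0]. Qed.

Lemma fpsC_linear (V : lmodType K) a (u v : V) :
  fpsC (a *: u + v) = hscale (fpsC (a : K^o)) (fpsC u) + fpsC v.
Proof.
apply/funext => n; rewrite fpsDE /hscale big_ord_recl /= subn0.
rewrite big1 ?addr0 => [|i _]; last by rewrite scale0r.
by case: n => [|n] //=; rewrite scaler0 addr0.
Qed.

Section Coefficients.
Variables (d : int) (V W : gradedVect) (F : hhom d V W) (n : nat).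

Let coef (v : V) : W := F (fpsC v) n.

Let coef_linear : linear coef.
Proof.
move=> a u v; rewrite /coef fpsC_linear hhom_add hhom_scale.
rewrite fpsDE /hscale big_ord_recl /= subn0 big1 ?addr0 // => i _.
by rewrite scale0r.
Qed.

Let coef_homog k v : homog k v -> homog (k + (d + (2 * n)%:Z)) (coef v).
Proof. by move=> /fpsC_homog/(hhom_homog F)/(_ n); rewrite addrA. Qed.

(* F_n, where F v = Σ_n h^n F_n v for v in V. *)
Definition hcoef : ghom (d + (2 * n)%:Z) V W := GHom coef_linear coef_homog.

End Coefficients.

Section Tensor.
Variables (d e : int) (V W V' W' : gradedVect).
Variables (F : hhom d V V') (G : hhom e W W').

(* The h^n-coefficient Σ_(i + j = n) F_i ⊗ G_j of F ⊗ G. *)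
Definition htens_coef (n : nat) (t : gtensor V W) : gtensor V' W' :=
  \sum_(i < n.+1) gtens (hcoef F i) (hcoef G (n - i)) t.

Lemma htens_coef_linear n : linear (htens_coef n).
Proof.
apply: (sum_lin _ _
  (F := fun i : 'I_n.+1 => gtens (hcoef F i) (hcoef G (n - i)))) => i.
exact: ghom_linear.
Qed.

Lemma htens_coef_homog n k (t : gtensor V W) : homog k t ->
  homog (k + (d + e + (2 * n)%:Z)) (htens_coef n t).
Proof.
move=> ht; apply: homog_sum => i.
have -> : d + e + (2 * n)%:Z =
    d + (2 * i)%:Z + (e + (2 * (n - i))%:Z) by case: i => i /=; lia.
exact: ghom_homog.
Qed.

(* The tensor product of K[[h]]-linear maps, on (V ⊗ W)[[h]]; since |h| is
   even the Koszul sign of F_i ⊗ G_j is that of F ⊗ G. *)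
Definition htens : hhom (d + e) (gtensor V W) (gtensor V' W') :=
  HHom (hext_add htens_coef_linear) (hext_scale htens_coef_linear)
       (hext_homog htens_coef_homog).

End Tensor.

Lemma hscale_hE (V : lmodType K) (u : fps V) n :
  hscale (fun m => (m == 1%N)%:R) u n = if n is m.+1 then u m else 0.
Proof.
rewrite /hscale; case: n => [|n]; first by rewrite big_ord1 scale0r.
rewrite 2!big_ord_recl /= scale0r add0r scale1r subn1 big1 ?addr0 // => i _.
by rewrite scale0r.
Qed.

Lemma hhom_coefE d V W (F : hhom d V W) (u : fps V) n :
  F u n = \sum_(i < n.+1) hcoef F i (u (n - i)%N).
Proof.
have uE (v : fps V) :
    v = hscale (fun m => (m == 1%N)%:R) (fun m => v m.+1) + fpsC (v 0%N).
  by apply/funext => -[|m]; rewrite fpsDE hscale_hE /= ?add0r ?addr0.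
elim: n u => [|n IH] u; rewrite {1}[u]uE hhom_add hhom_scale fpsDE hscale_hE.
  by rewrite add0r big_ord1.
rewrite IH [RHS]big_ord_recr subnn; congr (Algebra.add _ _).
by apply: eq_bigr => i _; rewrite /= subSn // -ltnS.
Qed.

Lemma koszul_sign_even e p (x y : int) :
  (-1 : K) ^ ((e + 2 * x) * (p + 2 * y)) = (-1) ^ (e * p).
Proof.
have -> : (e + 2 * x) * (p + 2 * y) = e * p + 2 * (x * p + (e + 2 * x) * y).
  by lia.
rewrite expfzDr ?oppr_eq0 ?oner_eq0 // -[X in _ * X]exprz_exp.
have -> : (-1 : K) ^ (2 : int) = 1 by rewrite [LHS]sqrrN expr1n.
by rewrite exp1rz mulr1.
Qed.

(* The product of series in V[[h]] and W[[h]]. *)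
Definition hpure V W (u : fps V) (w : fps W) : fps (gtensor V W) :=
  fun n => \sum_(i < n.+1) (u i ⊗ w (n - i)%N).

Lemma htens_pure d e V W V' W' (F : hhom d V V') (G : hhom e W W') p
    (u : fps V) (w : fps W) : hhomog p u ->
  htens F G (hpure u w) = (-1) ^ (e * p) *: hpure (F u) (G w).
Proof.
move=> hu; apply/funext => n.
rewrite fpsZE /= /hext /htens_coef /hpure.
have tl := (tpure_bilin V' W').1; have tr := (tpure_bilin V' W').2.
transitivity (\sum_(a < n.+1) \sum_(i < a.+1) \sum_(k < (n - a).+1)
    (-1) ^ (e * p) *:
      (hcoef F i (u k) ⊗ hcoef G (a - i) (w (n - a - k)%N))).
  apply: eq_bigr => a _; apply: eq_bigr => i _.
  rewrite (lin_sum _ _ _ (ghom_linear _)); apply: eq_bigr => k _.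
  rewrite (gtensE _ _ _ (hu k)); congr (_ *: _).
  by rewrite !PoszM koszul_sign_even.
rewrite (swap4_sum (fun i j k m => (-1) ^ (e * p) *:
  (hcoef F i (u k) ⊗ hcoef G j (w m)))).
rewrite scaler_sumr; apply: eq_bigr => b _.
rewrite !hhom_coefE (lin_sum _ _ _ (tl _)) scaler_sumr; apply: eq_bigr => i _.
by rewrite (lin_sum _ _ _ (tr _)) scaler_sumr.
Qed.

Lemma hhom_tensor_ext d V W X (F G : hhom d (gtensor V W) X) :
  (forall p q (v : V) (w : W), homog p v -> homog q w ->
    F (fpsC (v ⊗ w : gtensor V W)) = G (fpsC (v ⊗ w : gtensor V W))) ->
  F =1 G.
Proof.
move=> FG u; apply/funext => n; rewrite !hhom_coefE; apply: eq_bigr => i _.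
apply: (tensor_homog_ext (f := hcoef F i) (g := hcoef G i)).
- exact: ghom_linear (hcoef F i).
- exact: ghom_linear (hcoef G i).
by move=> p q v w hv hw; rewrite /= (FG p q).
Qed.

Lemma fpsC_pure V W (v : V) (w : W) :
  fpsC (v ⊗ w : gtensor V W) = hpure (fpsC v) (fpsC w).
Proof.
have [tl tr] := tpure_bilin V W.
apply/funext => n; rewrite /hpure big_ord_recl /= subn0 big1 => [|i _].
  by rewrite addr0; case: n => //= n; rewrite (lin0 (tr v)).
exact: lin0 (tl _).
Qed.

Lemma htens_id V W : htens (hid V) (hid W) =1 id.
Proof.
apply: (hhom_tensor_ext (G := hid (gtensor V W))) => p q v w hv hw.
rewrite fpsC_pure (htens_pure _ _ _ (fpsC_homog hv)).
by rewrite mul0r expr0z scale1r.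
Qed.

Lemma htens_comp U V W U' V' W' (G : hhom 0 V W) (G' : hhom 0 V' W')
    (F : hhom 0 U V) (F' : hhom 0 U' V') u :
  htens (hcomp G F) (hcomp G' F') u = htens G G' (htens F F' u).
Proof.
move: u; apply: (hhom_tensor_ext (F := htens (hcomp G F) (hcomp G' F'))
                          (G := hcomp (htens G G') (htens F F'))).
move=> p q v w /fpsC_homog hv /fpsC_homog hw; rewrite fpsC_pure.
rewrite -[RHS]/(htens G G' (htens F F' (hpure (fpsC v) (fpsC w)))).
rewrite !(htens_pure _ _ _ hv) !mul0r !expr0z !scale1r.
by rewrite (htens_pure _ _ _ (hhom_homog F hv)) mul0r expr0z scale1r.
Qed.

Record hdgca_data := HDGCAData {
  hdg_space :> gradedVect;
  hdg_coprod : hhom 0 hdg_space (gtensor hdg_space hdg_space);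
  hdg_diff : hhom 1 hdg_space hdg_space
}.

Definition hassoc (U V W : gradedVect)
    (t : fps (gtensor (gtensor U V) W)) : fps (gtensor U (gtensor V W)) :=
  fun n => tassoc (t n).

Record is_hdgca (C : hdgca_data) : Prop := IsHDGCA {
  hdg_coassoc : forall c : fps C,
    hassoc (htens (hdg_coprod C) (hid C) (hdg_coprod C c)) =
    htens (hid C) (hdg_coprod C) (hdg_coprod C c);
  hdg_flat : forall c : fps C, hdg_diff C (hdg_diff C c) = 0;
  hdg_coder : forall c : fps C,
    hdg_coprod C (hdg_diff C c) =
    htens (hid C) (hdg_diff C) (hdg_coprod C c) +
    htens (hdg_diff C) (hid C) (hdg_coprod C c)
}.

Record is_hdgca_hom (C D : hdgca_data) (phi : hhom 0 C D) : Prop :=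
IsHDGCAHom {
  hdg_hom_diff : forall c : fps C, phi (hdg_diff C c) = hdg_diff D (phi c);
  hdg_hom_coprod : forall c : fps C,
    htens phi phi (hdg_coprod C c) = hdg_coprod D (phi c)
}.

Record hdgca := HDGCAOb { hdgca_val :> hdgca_data; hdgca_law : is_hdgca hdgca_val }.

Record hdgca_hom (C D : hdgca) := HDGCAHom {
  hdgca_hom_val :> hhom 0 C D;
  hdgca_hom_law : is_hdgca_hom hdgca_hom_val
}.

Lemma hdgca_homP (C D : hdgca) (f g : hdgca_hom C D) : f =1 g -> f = g.
Proof.
case: f g => [f hf] [g hg] /= /hhomP fg; rewrite {}fg in hf *.
by congr HDGCAHom; exact: Prop_irrelevance.
Qed.

Lemma hdgca_id_law (C : hdgca) : is_hdgca_hom (hid C).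
Proof. by split=> c //=; exact: htens_id. Qed.

Lemma hdgca_comp_law (B C D : hdgca) (g : hdgca_hom C D)
    (f : hdgca_hom B C) : is_hdgca_hom (hcomp g f).
Proof.
case: g f => [g [gd gc]] [f [fd fc]]; split=> c; first by rewrite /= fd gd.
by rewrite htens_comp fc gc.
Qed.

Definition hdgca_id C : hdgca_hom C C := HDGCAHom (hdgca_id_law C).
Definition hdgca_comp B C D (g : hdgca_hom C D) (f : hdgca_hom B C) :
  hdgca_hom B D := HDGCAHom (hdgca_comp_law g f).

End Graded.

Record category := Category {
  cat_ob :> Type;
  cat_hom : cat_ob -> cat_ob -> Type;
  cat_id : forall A, cat_hom A A;
  cat_comp : forall A B C, cat_hom B C -> cat_hom A B -> cat_hom A C;
  cat_compA : forall A B C D (h : cat_hom C D) (g : cat_hom B C)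
    (f : cat_hom A B), cat_comp h (cat_comp g f) = cat_comp (cat_comp h g) f;
  cat_idl : forall A B (f : cat_hom A B), cat_comp (cat_id B) f = f;
  cat_idr : forall A B (f : cat_hom A B), cat_comp f (cat_id A) = f
}.

Record is_functor (X Y : category) (Fo : X -> Y)
    (Fm : forall A B : X, cat_hom A B -> cat_hom (Fo A) (Fo B)) : Prop :=
IsFunctor {
  functor_id : forall A : X, Fm A A (cat_id A) = cat_id (Fo A);
  functor_comp : forall (A B C : X) (g : cat_hom B C) (f : cat_hom A B),
    Fm A C (cat_comp g f) = cat_comp (Fm B C g) (Fm A B f)
}.

Definition is_faithful (X Y : category) (Fo : X -> Y)
    (Fm : forall A B : X, cat_hom A B -> cat_hom (Fo A) (Fo B)) : Prop :=
  forall A B : X, injective (Fm A B).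

Section DGCA.
Variable K : fieldType.

Lemma dgca_compA (A B C D : dgca K) (f3 : dgca_hom C D) (f2 : dgca_hom B C)
    (f1 : dgca_hom A B) :
  dgca_comp f3 (dgca_comp f2 f1) = dgca_comp (dgca_comp f3 f2) f1.
Proof. exact: dgca_homP. Qed.

Lemma dgca_idl (A B : dgca K) (f : dgca_hom A B) : dgca_comp (dgca_id B) f = f.
Proof. exact: dgca_homP. Qed.

Lemma dgca_idr (A B : dgca K) (f : dgca_hom A B) : dgca_comp f (dgca_id A) = f.
Proof. exact: dgca_homP. Qed.

Definition DGCA : category := Category dgca_compA dgca_idl dgca_idr.

End DGCA.

Section DGCAh.
Variable K : fieldType.

Lemma hdgca_compA (A B C D : hdgca K) (f3 : hdgca_hom C D) (f2 : hdgca_hom B C)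
    (f1 : hdgca_hom A B) :
  hdgca_comp f3 (hdgca_comp f2 f1) = hdgca_comp (hdgca_comp f3 f2) f1.
Proof. exact: hdgca_homP. Qed.

Lemma hdgca_idl (A B : hdgca K) (f : hdgca_hom A B) : hdgca_comp (hdgca_id B) f = f.
Proof. exact: hdgca_homP. Qed.

Lemma hdgca_idr (A B : hdgca K) (f : hdgca_hom A B) : hdgca_comp f (hdgca_id A) = f.
Proof. exact: hdgca_homP. Qed.

Definition DGCAh : category := Category hdgca_compA hdgca_idl hdgca_idr.

End DGCAh.

Section Twist.
Variable R : realType.

Definition ihbar : fps R[i] := fun n => if n == 1%N then 'i%C else 0.

Variable C : dgca_data R[i].

Let D := hlift (dg_coprod C).
Let dd := hlift (gtens (dg_diff C) (dg_diff C)).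

Definition twist_fun (c : fps C) : fps (gtensor C C) :=
  D c + hscale ihbar (dd (D c)).

Lemma hscaleDr (K : fieldType) (V : lmodType K) (a : fps K) (u v : fps V) :
  hscale a (u + v) = hscale a u + hscale a v.
Proof.
apply/funext => n; rewrite fpsDE -big_split /=; apply: eq_bigr => i _.
by rewrite fpsDE scalerDr.
Qed.

Lemma hscaleCA (K : fieldType) (V : lmodType K) (a b : fps K) (u : fps V) :
  hscale a (hscale b u) = hscale b (hscale a u).
Proof.
apply/funext => n; rewrite /hscale.
under eq_bigr do rewrite scaler_sumr.
under [RHS]eq_bigr do rewrite scaler_sumr.
rewrite (swap_sum (fun i j m => a i *: (b j *: u m))).
by apply: eq_bigr => i _; apply: eq_bigr => j _; rewrite !scalerA mulrC.
Qed.

Lemma twist_add u v : twist_fun (u + v) = twist_fun u + twist_fun v.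
Proof. by rewrite /twist_fun !hhom_add hscaleDr addrACA. Qed.

Lemma twist_scale a u : twist_fun (hscale a u) = hscale a (twist_fun u).
Proof. by rewrite /twist_fun !hhom_scale hscaleDr hscaleCA. Qed.

Lemma twist_homog k u : hhomog k u -> hhomog (k + 0) (twist_fun u).
Proof.
move=> hu n; have hD := hhom_homog D hu; apply: homogD; first exact: hD.
apply: homog_sum => -[i /= lin]; rewrite /ihbar.
case: (i =P 1%N) => [i1|_]; last by rewrite scale0r; exact: homog0.
have -> : k + 0 + (2 * n)%:Z = k + 0 + (1 + 1) + (2 * (n - i))%:Z by lia.
apply: homogZ; exact: (hhom_homog dd hD).
Qed.

(* Δ_C + i h (d_C ⊗ d_C) Δ_C on C[[h]]. *)
Definition twist_coprod : hhom 0 C (gtensor C C) :=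
  HHom twist_add twist_scale twist_homog.

Definition twist : hdgca_data R[i] :=
  HDGCAData twist_coprod (hlift (dg_diff C)).

End Twist.

(* Main.v *)
Require Import Defs.
From mathcomp Require Import all_boot all_order all_algebra.
From mathcomp Require Import boolp reals complex.
From mathcomp Require Import zify.

Set Implicit Arguments.
Unset Strict Implicit.
Unset Printing Implicit Defensive.
Local Open Scope ring_scope.

Import GRing.Theory.

(** Write [Δ2 = (d ⊗ d) Δ] ([diff2_coprod]) and [h = iħ], so that the new coproduct is
    [Δ + h Δ2].  Each law it has to satisfy is polynomial in [h] and can be
    checked one power of [h] at a time, in the category of graded vector spaces.

    - Coassociativity.  In order 0 it is coassociativity of [Δ].  In order 1,
      the coderivation rule turns [(Δ ⊗ 1) Δ2] into
      [(1 ⊗ d ⊗ d + d ⊗ 1 ⊗ d) (Δ ⊗ 1) Δ], while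
      [(Δ2 ⊗ 1) Δ = (d ⊗ d ⊗ 1) (Δ ⊗ 1) Δ]: together they give the sum over all
      ways of putting [d] on two of the three factors.  The other bracketing
      gives the same symmetric sum ([coassoc_diff2]).  In order 2 both sides
      vanish, since [(Δ2 ⊗ 1) (d ⊗ d) = (Δ2 d) ⊗ d] and [Δ2 d = 0]
      ([diff2_coprod_gtens]).
    - Coderivation.  In order 1 both sides vanish because [d] meets itself in
      one of the factors: [(d ⊗ d) (1 ⊗ d + d ⊗ 1) = 0] and
      [(1 ⊗ d) (d ⊗ d) = 0 = (d ⊗ 1) (d ⊗ d)]
      ([diff2_coprod_diff], [diff_gtens_diff2]).
    - Morphisms.  A morphism commutes with [Δ] and with [d], hence with [Δ2]
      ([diff2_coprod_natural]).

    The Koszul signs are dealt with in the composition rule [gtens_compose] and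
    in the naturality [tassoc_gtens] of the associator.  The passage from
    [K[[ħ]]]-linear to [K]-linear maps is [htens_affinel] and [htens_affiner]:
    a tensor product with a factor of the form [f0 + a f1], where [a] is a
    series, is itself of that form.  The argument is the same over any field and
    for any series [a] in place of [iħ].  Functoriality is immediate because
    morphisms are extended coefficientwise, and a morphism is recovered from its
    extension by evaluating at constant series, whence faithfulness. *)

(** * Koszul tensor products of graded maps *)

Section GradedMaps.
Variable K : fieldType.
Implicit Types U V W X : gradedVect K.

Lemma gcompose_homog d e U V W (g : ghom e V W) (f : ghom d U V) k (u : U) :
  homog k u -> homog (k + (d + e)) ((g \o f) u).
Proof. by rewrite addrA => /(ghom_homog f)/(ghom_homog g). Qed.

Definition gcompose d e U V W (g : ghom e V W) (f : ghom d U V) :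
  ghom (d + e) U W :=
  GHom (lin_comp (ghom_linear g) (ghom_linear f)) (gcompose_homog g f).

Lemma lincomb_linear (V W : lmodType K) (f g : V -> W) a b :
  linear f -> linear g -> linear (fun v => a *: f v + b *: g v).
Proof.
move=> lf lg c u v; rewrite lf lg !scalerDr !scalerA (mulrC a) (mulrC b).
exact: addrACA.
Qed.

(** The degrees of [f0] and [f1] are unrelated to that of [f]: the Koszul sign
    only involves the degree of the right factor.  This is what allows the
    coefficients of a [K[[ħ]]]-linear map, which have varying degrees, to be
    compared with a fixed graded map. *)
Lemma gtens_lincombl d d0 d1 e V W V' W' (f : ghom d V V') (f0 : ghom d0 V V')
    (f1 : ghom d1 V V') (g : ghom e W W') a b (t : gtensor V W) :
  (forall v, f v = a *: f0 v + b *: f1 v) ->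
  gtens f g t = a *: gtens f0 g t + b *: gtens f1 g t.
Proof.
move=> fE; move: t; apply: (@tensor_homog_ext _ _ _ (gtensor V' W') (gtens f g)
  (fun t => a *: gtens f0 g t + b *: gtens f1 g t)).
- exact: ghom_linear (gtens f g).
- exact: lincomb_linear (ghom_linear (gtens f0 g)) (ghom_linear (gtens f1 g)).
move=> p q v w hv hw; rewrite !(gtensE _ _ _ hv) fE.
rewrite (linD ((tpure_bilin _ _).1 _)) !(linZ ((tpure_bilin _ _).1 _)).
by rewrite scalerDr !scalerA (mulrC a) (mulrC b).
Qed.

Lemma sign_shift e m p : (-1 : K) ^ ((e + 2 * m) * p) = (-1) ^ (e * p).
Proof. by have := @koszul_sign_even K e p m 0; rewrite mulr0 addr0. Qed.

(** On the right the degrees may differ by even integers only, as the Koszul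
    sign depends on the parity of the degree of the right factor. *)
Lemma gtens_lincombr d e e0 e1 m0 m1 V W V' W' (f : ghom d V V')
    (g : ghom e W W') (g0 : ghom e0 W W') (g1 : ghom e1 W W') a b
    (t : gtensor V W) :
  e = e0 + 2 * m0 -> e = e1 + 2 * m1 ->
  (forall w, g w = a *: g0 w + b *: g1 w) ->
  gtens f g t = a *: gtens f g0 t + b *: gtens f g1 t.
Proof.
move=> e0E e1E gE; move: t; apply: (@tensor_homog_ext _ _ _ (gtensor V' W')
  (gtens f g) (fun t => a *: gtens f g0 t + b *: gtens f g1 t)).
- exact: ghom_linear (gtens f g).
- exact: lincomb_linear (ghom_linear (gtens f g0)) (ghom_linear (gtens f g1)).
move=> p q v w hv hw; rewrite !(gtensE _ _ _ hv) gE.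
have s0 : (-1 : K) ^ (e * p) = (-1) ^ (e0 * p) by rewrite e0E sign_shift.
have s1 : (-1 : K) ^ (e * p) = (-1) ^ (e1 * p) by rewrite e1E sign_shift.
rewrite -s0 -s1 (linD ((tpure_bilin _ _).2 _)) !(linZ ((tpure_bilin _ _).2 _)).
by rewrite scalerDr !scalerA (mulrC a) (mulrC b).
Qed.

(** The interchange law; moving [g'] past [f] costs the sign. *)
Lemma gtens_compose d e d' e' U V W U' V' W' (g : ghom e V W)
    (g' : ghom e' V' W') (f : ghom d U V) (f' : ghom d' U' V')
    (t : gtensor U U') :
  gtens g g' (gtens f f' t) =
  (-1) ^ (e' * d) *: gtens (gcompose g f) (gcompose g' f') t.
Proof.
move: t; apply: (tensor_homog_ext (f := gtens g g' \o gtens f f')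
  (g := fun t => (-1) ^ (e' * d) *: gtens (gcompose g f) (gcompose g' f') t)).
- exact: lin_comp (ghom_linear (gtens g g')) (ghom_linear (gtens f f')).
- exact: lin_comp (@scale_linear _ _ _)
    (ghom_linear (gtens (gcompose g f) (gcompose g' f'))).
move=> p q v w hv hw; rewrite -[LHS]/(gtens g g' (gtens f f' (v ⊗ w))).
rewrite !(gtensE _ _ _ hv) (linZ (ghom_linear _)).
rewrite (gtensE _ _ _ (ghom_homog f hv)) !scalerA.
congr (_ *: _); rewrite -!expfzDr ?oppr_eq0 ?oner_eq0 //.
by congr (_ ^ _); lia.
Qed.

Lemma gtens_compose_evenr d e d' U V W U' V' W' (g : ghom e V W)
    (g' : ghom 0 V' W') (f : ghom d U V) (f' : ghom d' U' V')
    (t : gtensor U U') :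
  gtens g g' (gtens f f' t) = gtens (gcompose g f) (gcompose g' f') t.
Proof. by rewrite gtens_compose mul0r expr0z scale1r. Qed.

Lemma gtens_compose_evenl e d' e' U V W U' V' W' (g : ghom e V W)
    (g' : ghom e' V' W') (f : ghom 0 U V) (f' : ghom d' U' V')
    (t : gtensor U U') :
  gtens g g' (gtens f f' t) = gtens (gcompose g f) (gcompose g' f') t.
Proof. by rewrite gtens_compose mulr0 expr0z scale1r. Qed.

Lemma tensor3_homog_ext U V W (X : lmodType K)
    (f g : tensor (gtensor U V) W -> X) : linear f -> linear g ->
  (forall p q r (u : U) (v : V) (w : W), homog p u -> homog q v ->
    homog r w -> f (u ⊗ v ⊗ w) = g (u ⊗ v ⊗ w)) -> f =1 g.
Proof.
move=> lf lg fg; have [tl tr] := tpure_bilin (gtensor U V) W.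
apply: tens_ext => // t.
apply: (homog_ext (lin_comp lf (tr t)) (lin_comp lg (tr t))) => r w hw.
move: t; apply: (tensor_homog_ext (lin_comp lf (tl w)) (lin_comp lg (tl w))).
by move=> p q u v hu hv; exact: fg hu hv hw.
Qed.

(** On [u ⊗ v ⊗ w] both sides carry the sign of moving [h] past [u] and [v], and
    [g] past [u], so no sign is left over. *)
Lemma tassoc_gtens d e k U V W U' V' W' (f : ghom d U U') (g : ghom e V V')
    (h : ghom k W W') (t : gtensor (gtensor U V) W) :
  tassoc (gtens (gtens f g) h t) = gtens f (gtens g h) (tassoc t).
Proof.
have lA := @tassoc_linear K.
have lL := lin_comp (lA U' V' W') (ghom_linear (gtens (gtens f g) h)).
have lR := lin_comp (ghom_linear (gtens f (gtens g h))) (lA U V W).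
move: t; apply: (tensor3_homog_ext lL lR) => p q r u v w hu hv hw.
rewrite -[LHS]/(tassoc (gtens (gtens f g) h (u ⊗ v ⊗ w))).
rewrite -[RHS]/(gtens f (gtens g h) (tassoc (u ⊗ v ⊗ w))).
rewrite tassocE !(gtensE _ _ _ hu) (gtensE _ _ _ hv).
rewrite (gtensE _ _ _ (tpure_homog hu hv)) (gtensE _ _ _ hu).
rewrite (linZ ((tpure_bilin _ _).1 _)) (linZ ((tpure_bilin _ _).2 _)).
rewrite !(linZ (lA _ _ _)) tassocE !scalerA; congr (_ *: _).
rewrite -!expfzDr ?oppr_eq0 ?oner_eq0 //.
by congr (_ ^ _); lia.
Qed.

Lemma gtens_0l d e V W V' W' (f : ghom d V V') (g : ghom e W W')
    (t : gtensor V W) : (forall v, f v = 0) -> gtens f g t = 0.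
Proof.
move=> f0; rewrite (@gtens_lincombl _ _ _ _ _ _ _ _ f f f g 0 0) => [|v].
  by rewrite !scale0r addr0.
by rewrite f0 !scale0r addr0.
Qed.

Lemma gtens_0r d e V W V' W' (f : ghom d V V') (g : ghom e W W')
    (t : gtensor V W) : (forall w, g w = 0) -> gtens f g t = 0.
Proof.
move=> g0.
rewrite (@gtens_lincombr _ _ _ _ 0 0 _ _ _ _ f g g g 0 0) ?mulr0 ?addr0 //.
  by rewrite !scale0r addr0.
by move=> w; rewrite g0 !scale0r addr0.
Qed.

Lemma gtens_Dl d d0 d1 e V W V' W' (f : ghom d V V') (f0 : ghom d0 V V')
    (f1 : ghom d1 V V') (g : ghom e W W') (t : gtensor V W) :
  (forall v, f v = f0 v + f1 v) ->
  gtens f g t = gtens f0 g t + gtens f1 g t.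
Proof.
move=> fE; rewrite (@gtens_lincombl _ _ _ _ _ _ _ _ f f0 f1 g 1 1).
  by rewrite !scale1r.
by move=> v; rewrite fE !scale1r.
Qed.

Lemma gtens_Dr d e e0 e1 V W V' W' (f : ghom d V V')
    (g : ghom e W W') (g0 : ghom e0 W W') (g1 : ghom e1 W W')
    (t : gtensor V W) : e = e0 -> e = e1 ->
  (forall w, g w = g0 w + g1 w) ->
  gtens f g t = gtens f g0 t + gtens f g1 t.
Proof.
move=> e0E e1E gE.
rewrite (@gtens_lincombr _ _ _ _ 0 0 _ _ _ _ f g g0 g1 1 1) ?mulr0 ?addr0 //.
  by rewrite !scale1r.
by move=> w; rewrite gE !scale1r.
Qed.

Lemma gtens_eq d d' e e' V W V' W' (f : ghom d V V') (f' : ghom d' V V')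
    (g : ghom e W W') (g' : ghom e' W W') (t : gtensor V W) :
  e = e' -> f =1 f' -> g =1 g' -> gtens f g t = gtens f' g' t.
Proof.
move=> eE fE gE.
rewrite (@gtens_lincombl _ _ _ _ _ _ _ _ f f' f' g 1 0); last first.
  by move=> v; rewrite fE scale1r scale0r addr0.
rewrite (@gtens_lincombr _ _ _ _ 0 0 _ _ _ _ f' g g' g' 1 0) ?mulr0 ?addr0 //.
  by rewrite !scale1r !scale0r !addr0.
by move=> w; rewrite gE scale1r scale0r addr0.
Qed.

(** * Tensor products of maps of power series *)

Lemma hcoef_affine d d0 d1 V W (F : hhom d V W) (f0 : ghom d0 V W)
    (f1 : ghom d1 V W) a n v :
  (forall u, F u = hlift f0 u + hscale a (hlift f1 u)) ->
  hcoef F n v = (n == 0%N)%:R *: f0 v + a n *: f1 v.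
Proof.
move=> FE; rewrite /= FE fpsDE /hscale big_ord_recr /= subnn.
rewrite big1 ?add0r => [|i _]; last first.
  move: (ltn_ord i); rewrite -subn_gt0; case: (n - i)%N => //= m _.
  by rewrite (lin0 (ghom_linear f1)) scaler0.
by case: n => [|n]; rewrite ?scale1r //= scale0r (lin0 (ghom_linear f0)).
Qed.

Lemma hcoef_hlift d V W (f : ghom d V W) n v :
  hcoef (hlift f) n v = (n == 0%N)%:R *: f v.
Proof.
case: n => [|n] /=; first by rewrite scale1r.
by rewrite scale0r (lin0 (ghom_linear f)).
Qed.

Lemma htens_coef_liftr d e V W V' W' (F : hhom d V V') (g : ghom e W W') n t :
  htens_coef F (hlift g) n t = gtens (hcoef F n) g t.
Proof.
have E k i : gtens (hcoef F i) (hcoef (hlift g) k) t =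
    (k == 0%N)%:R *: gtens (hcoef F i) g t.
  rewrite (@gtens_lincombr _ _ _ _ k%:Z k%:Z _ _ _ _ (hcoef F i)
    (hcoef (hlift g) k) g g (k == 0%N)%:R 0) //.
    by rewrite scale0r addr0.
  by move=> w; rewrite hcoef_hlift scale0r addr0.
rewrite /htens_coef (eq_bigr _ (fun i : 'I_n.+1 => fun _ => E (n - i)%N i)).
rewrite big_ord_recr subnn scale1r big1 => [|i _]; first exact: add0r.
have /negPf -> : (n - i)%N != 0%N by rewrite -lt0n subn_gt0 (ltn_ord i).
by rewrite scale0r.
Qed.

Lemma htens_coef_liftl d e V W V' W' (f : ghom d V V') (G : hhom e W W') n t :
  htens_coef (hlift f) G n t = gtens f (hcoef G n) t.
Proof.
have E i k : gtens (hcoef (hlift f) i) (hcoef G k) t =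
    (i == 0%N)%:R *: gtens f (hcoef G k) t.
  rewrite (@gtens_lincombl _ _ _ _ _ _ _ _ (hcoef (hlift f) i) f f
    (hcoef G k) (i == 0%N)%:R 0).
    by rewrite scale0r addr0.
  by move=> w; rewrite hcoef_hlift scale0r addr0.
rewrite /htens_coef (eq_bigr _ (fun i : 'I_n.+1 => fun _ => E i (n - i)%N)).
rewrite big_ord_recl subn0 scale1r big1 ?addr0 // => i _.
by rewrite scale0r.
Qed.

Lemma hext_affine V W (T : nat -> V -> W) (f0 f1 : V -> W) a (u : fps V) :
  (forall n v, T n v = (n == 0%N)%:R *: f0 v + a n *: f1 v) ->
  hext T u = ((fun n => f0 (u n)) : fps W) + @hscale K W a (fun n => f1 (u n)).
Proof.
move=> TE; apply/funext => n; rewrite fpsDE /hext /hscale.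
under eq_bigr do rewrite TE.
rewrite big_split /= big_ord_recl /= subn0 scale1r; congr (_ + _).
by rewrite big1 ?addr0 // => i _; rewrite scale0r.
Qed.

(** The coefficients of [f0 + a f1] are [f0 + a_0 f1] and the multiples [a_n f1],
    so tensoring with the extension of [g] coefficientwise yields the series
    [f0 ⊗ g + a (f1 ⊗ g)]. *)
Lemma htens_affinel d d0 d1 e V W V' W' (F : hhom d V V') (f0 : ghom d0 V V')
    (f1 : ghom d1 V V') (g : ghom e W W') a (u : fps (gtensor V W)) :
  (forall u, F u = hlift f0 u + hscale a (hlift f1 u)) ->
  htens F (hlift g) u =
  hlift (gtens f0 g) u + hscale a (hlift (gtens f1 g) u).
Proof.
move=> FE; apply: hext_affine => n t; rewrite htens_coef_liftr.
by apply: gtens_lincombl => v; exact: hcoef_affine.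
Qed.

Lemma htens_affiner d e e0 e1 m0 m1 V W V' W' (f : ghom d V V')
    (G : hhom e W W') (g0 : ghom e0 W W') (g1 : ghom e1 W W') a
    (u : fps (gtensor V W)) :
  e = e0 + 2 * m0 -> e = e1 + 2 * m1 ->
  (forall u, G u = hlift g0 u + hscale a (hlift g1 u)) ->
  htens (hlift f) G u =
  hlift (gtens f g0) u + hscale a (hlift (gtens f g1) u).
Proof.
move=> e0E e1E GE; apply: hext_affine => n t; rewrite htens_coef_liftl.
apply: (@gtens_lincombr _ _ _ _ (m0 + n%:Z) (m1 + n%:Z)).
- by rewrite e0E PoszM; lia.
- by rewrite e1E PoszM; lia.
by move=> v; exact: hcoef_affine.
Qed.

Lemma htens_hlift d e V W V' W' (f : ghom d V V') (g : ghom e W W')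
    (u : fps (gtensor V W)) :
  htens (hlift f) (hlift g) u = hlift (gtens f g) u.
Proof.
(* The case a = 0, where f1 may be arbitrary. *)
pose z : fps K := fun=> 0.
have z0 (X : lmodType K) (v : fps X) : hscale z v = 0.
  by apply/funext => n; rewrite /hscale big1 // => i _; rewrite scale0r.
rewrite (@htens_affinel _ _ _ _ _ _ _ _ _ f f g z) ?z0 ?addr0 // => v.
by rewrite z0 addr0.
Qed.

Lemma hlift_gid V : hlift (gid V) = hid V.
Proof. exact: hhomP. Qed.

End GradedMaps.

(** * The coproduct (d ⊗ d) Δ *)

Section SquaredDiff.
Variables (K : fieldType) (C : dgca K).

Local Notation Δ := (dg_coprod C).
Local Notation d := (dg_diff C).
Local Notation id1 := (gid C).

Let lawC : is_dgca C := dgca_law C.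
Let flat (c : C) : d (d c) = 0 := dg_flat lawC c.

Definition diff2_coprod := gcompose (gtens d d) Δ.

(** In [(d ⊗ d) (1 ⊗ d)] and [(d ⊗ d) (d ⊗ 1)] one factor is [d d = 0]. *)
Lemma diff2_gtens_diff t :
  gtens d d (gtens id1 d t) = 0 /\ gtens d d (gtens d id1 t) = 0.
Proof.
rewrite !gtens_compose (gtens_0r _ (g := gcompose d d)) ?scaler0 //.
by rewrite (gtens_0l (f := gcompose d d)) ?scaler0.
Qed.

Lemma diff_gtens_diff2 t :
  gtens id1 d (gtens d d t) = 0 /\ gtens d id1 (gtens d d t) = 0.
Proof.
rewrite !gtens_compose (gtens_0r _ (g := gcompose d d)) ?scaler0 //.
by rewrite (gtens_0l (f := gcompose d d)) ?scaler0.
Qed.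

Lemma diff2_coprod_diff c : diff2_coprod (d c) = 0.
Proof.
rewrite -[LHS]/(gtens d d (Δ (d c))) (dg_coder lawC) (linD (ghom_linear _)).
by have [-> ->] := diff2_gtens_diff (Δ c); rewrite addr0.
Qed.

Lemma diff2_coprod_gtens t :
  gtens diff2_coprod id1 (gtens d d t) = 0 /\
  gtens id1 diff2_coprod (gtens d d t) = 0.
Proof.
rewrite !gtens_compose (gtens_0l (f := gcompose diff2_coprod d)); last first.
  exact: diff2_coprod_diff.
rewrite (gtens_0r _ (g := gcompose diff2_coprod d)) ?scaler0 //.
exact: diff2_coprod_diff.
Qed.

(** Since [Δ] is even, [(Δ ⊗ 1) (d ⊗ d) = (Δ d) ⊗ d]; the coderivation rule
    then moves [d] to the left of [Δ]. *)
Lemma coprod_gtens_diff2l t :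
  gtens Δ id1 (gtens d d t) =
  gtens (gtens id1 d) d (gtens Δ id1 t) +
  gtens (gtens d id1) d (gtens Δ id1 t).
Proof.
rewrite gtens_compose_evenr.
rewrite (@gtens_Dl _ _ _ _ _ _ _ _ _ (gcompose Δ d)
  (gcompose (gtens id1 d) Δ) (gcompose (gtens d id1) Δ)); last first.
  exact: dg_coder lawC.
by congr (_ + _); rewrite gtens_compose_evenl; apply: gtens_eq.
Qed.

Lemma coprod_gtens_diff2r t :
  gtens id1 Δ (gtens d d t) =
  gtens d (gtens id1 d) (gtens id1 Δ t) +
  gtens d (gtens d id1) (gtens id1 Δ t).
Proof.
rewrite gtens_compose_evenr.
rewrite (@gtens_Dr _ _ _ _ _ _ _ _ _ _ (gcompose Δ d)
  (gcompose (gtens id1 d) Δ) (gcompose (gtens d id1) Δ)) //; last first.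
  exact: dg_coder lawC.
by congr (_ + _); rewrite gtens_compose_evenl; apply: gtens_eq.
Qed.

Lemma coassoc_gtens (d1 d2 d3 : int) (f : ghom d1 C C) (g : ghom d2 C C)
    (h : ghom d3 C C) c :
  tassoc (gtens (gtens f g) h (gtens Δ id1 (Δ c))) =
  gtens f (gtens g h) (gtens id1 Δ (Δ c)).
Proof. by rewrite (tassoc_gtens f g h) -(dg_coassoc lawC). Qed.

(** Coassociativity in order 1: each side is the sum of [1 ⊗ d ⊗ d],
    [d ⊗ 1 ⊗ d] and [d ⊗ d ⊗ 1] applied to the iterated coproduct of [c]. *)
Lemma coassoc_diff2 c :
  tassoc (gtens Δ id1 (diff2_coprod c)) + tassoc (gtens diff2_coprod id1 (Δ c))
  = gtens id1 Δ (diff2_coprod c) + gtens id1 diff2_coprod (Δ c).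
Proof.
have -> : gtens diff2_coprod id1 (Δ c) =
    gtens (gtens d d) id1 (gtens Δ id1 (Δ c)).
  by rewrite gtens_compose_evenl.
have -> : gtens id1 diff2_coprod (Δ c) =
    gtens id1 (gtens d d) (gtens id1 Δ (Δ c)).
  by rewrite gtens_compose_evenl.
rewrite coprod_gtens_diff2l coprod_gtens_diff2r.
rewrite (linD (@tassoc_linear _ _ _ _)).
(* Stated for abstract summands: rewriting in place would compare the three
   distinct tensor products up to unfolding. *)
have cycle (M : zmodType) (x y z x' y' z' : M) :
    x = x' -> y = y' -> z = z' -> x + y + z = y' + z' + x'.
  by move=> -> -> ->; rewrite -addrA addrC.
by apply: cycle; exact: coassoc_gtens.
Qed.

End SquaredDiff.

(** * The deformed coalgebra and its morphisms *)

Section Deformation.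
Variable K : fieldType.

Lemma addr_hscale0 (V : lmodType K) (a : fps K) (u : fps V) :
  u + hscale a 0 = u.
Proof.
apply/funext => n; rewrite fpsDE /hscale big1 ?addr0 // => i _.
exact: scaler0.
Qed.

(** The order 2 term vanishes and the two order 1 terms are put together. *)
Lemma hscale_collect (V : lmodType K) (a : fps K) (u v w : fps V) :
  u + hscale a v + hscale a (w + hscale a 0) = u + hscale a (v + w).
Proof. by rewrite addr_hscale0 hscaleDr addrA. Qed.

Lemma hassocD (U V W : gradedVect K)
    (s t : fps (gtensor (gtensor U V) W)) :
  hassoc (s + t) = hassoc s + hassoc t.
Proof. by apply/funext => n; exact: linD (@tassoc_linear _ _ _ _) _ _. Qed.

Lemma hassocZ (U V W : gradedVect K) a
    (t : fps (gtensor (gtensor U V) W)) :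
  hassoc (hscale a t) = hscale a (hassoc t).
Proof.
apply/funext => n; have lA := @tassoc_linear _ U V W.
rewrite /hassoc (lin_sum _ _ _ lA).
by apply: eq_bigr => i _; rewrite (linZ lA).
Qed.

Section Object.
Variables (C : dgca K) (a : fps K) (F : hhom 0 C (gtensor C C)).
Hypothesis FE : forall u,
  F u = hlift (dg_coprod C) u + hscale a (hlift (diff2_coprod C) u).

Local Notation Δ := (dg_coprod C).
Local Notation d := (dg_diff C).
Local Notation id1 := (gid C).
Local Notation Δ2 := (diff2_coprod C).

Lemma deformation_coassoc c :
  hassoc (htens F (hid C) (F c)) = htens (hid C) F (F c).
Proof.
rewrite -hlift_gid (htens_affinel _ _ FE).
(* [Δ2] has degree 2 and [F] degree 0 = 2 + 2 * (-1), hence equal parity. *)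
rewrite (htens_affiner (m0 := 0) (m1 := -1) _ _ _ _ FE) //.
rewrite FE !hhom_add !hhom_scale.
have -> : hlift (gtens Δ2 id1) (hlift Δ2 c) = 0.
  by apply/funext => n; exact: (diff2_coprod_gtens (Δ (c n))).1.
have -> : hlift (gtens id1 Δ2) (hlift Δ2 c) = 0.
  by apply/funext => n; exact: (diff2_coprod_gtens (Δ (c n))).2.
rewrite !hscale_collect hassocD hassocZ hassocD.
congr (_ + hscale a _); apply/funext => n.
  exact: (dg_coassoc (dgca_law C)).
exact: coassoc_diff2.
Qed.

Lemma deformation_coder c :
  F (hlift d c) =
  htens (hid C) (hlift d) (F c) + htens (hlift d) (hid C) (F c).
Proof.
rewrite -hlift_gid !htens_hlift !FE !hhom_add !hhom_scale.
have -> : hlift Δ2 (hlift d c) = 0.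
  by apply/funext => n; exact: diff2_coprod_diff.
have -> : hlift (gtens id1 d) (hlift Δ2 c) = 0.
  by apply/funext => n; exact: (diff_gtens_diff2 (Δ (c n))).1.
have -> : hlift (gtens d id1) (hlift Δ2 c) = 0.
  by apply/funext => n; exact: (diff_gtens_diff2 (Δ (c n))).2.
rewrite !addr_hscale0; apply/funext => n.
exact: (dg_coder (dgca_law C)).
Qed.

Lemma deformation_is_hdgca : is_hdgca (HDGCAData F (hlift d)).
Proof.
split=> c; [exact: deformation_coassoc | | exact: deformation_coder].
by apply/funext => n; exact: (dg_flat (dgca_law C)).
Qed.

End Object.

Lemma diff2_coprod_natural (C D : dgca K) (f : dgca_hom C D) c :
  gtens f f (diff2_coprod C c) = diff2_coprod D (f c).
Proof.
have [fd fc] := dgca_hom_law f.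
rewrite -[LHS]/(gtens f f (gtens (dg_diff C) (dg_diff C) (dg_coprod C c))).
rewrite -[RHS]/(gtens (dg_diff D) (dg_diff D) (dg_coprod D (f c))).
by rewrite -fc gtens_compose_evenr gtens_compose_evenl; apply: gtens_eq.
Qed.

Lemma deformation_is_hdgca_hom (C D : dgca K) (f : dgca_hom C D) a
    (F : hhom 0 C (gtensor C C)) (G : hhom 0 D (gtensor D D)) :
  (forall u,
    F u = hlift (dg_coprod C) u + hscale a (hlift (diff2_coprod C) u)) ->
  (forall u,
    G u = hlift (dg_coprod D) u + hscale a (hlift (diff2_coprod D) u)) ->
  @is_hdgca_hom K (HDGCAData F (hlift (dg_diff C)))
    (HDGCAData G (hlift (dg_diff D))) (hlift f).
Proof.
move=> FE GE; have [fd fc] := dgca_hom_law f.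
split=> c; first by apply/funext => n; exact: fd.
rewrite -[LHS]/(htens (hlift f) (hlift f) (F c)) -[RHS]/(G (hlift f c)).
rewrite htens_hlift FE GE hhom_add hhom_scale.
congr (_ + hscale a _); apply/funext => n; first exact: fc.
exact: diff2_coprod_natural.
Qed.

Lemma hlift_inj d (V W : gradedVect K) : injective (@hlift K d V W).
Proof.
move=> f g fg; apply: ghomP => v.
by rewrite -[LHS]/(hlift f (fpsC v) 0%N) fg.
Qed.

End Deformation.

(* The existence of [HO] and [HM] says that D(C) is an object of DGCA[[h]] and
   that the extension of a morphism is a morphism. *)
Theorem proposition3p0p2 (R : realType) :
  exists (HO : forall C : dgca R[i], is_hdgca (twist C))
         (HM : forall (C D : dgca R[i]) (f : dgca_hom C D),
            @is_hdgca_hom R[i] (twist C) (twist D) (hlift f)),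
    let Dob (C : dgca R[i]) : hdgca R[i] := HDGCAOb (HO C) in
    let Dmor (C D : dgca R[i]) (f : dgca_hom C D) :
      hdgca_hom (Dob C) (Dob D) :=
        @HDGCAHom R[i] (Dob C) (Dob D) (hlift f) (HM C D f) in
    @is_functor (DGCA R[i]) (DGCAh R[i]) Dob Dmor /\
    @is_faithful (DGCA R[i]) (DGCAh R[i]) Dob Dmor.
Proof.
have HO (C : dgca R[i]) : is_hdgca (twist C).
  (* [twist_coprod C] unfolds to the affine form with the series iħ. *)
  exact: (@deformation_is_hdgca _ C (ihbar R)).
have HM (C D : dgca R[i]) (f : dgca_hom C D) :
    @is_hdgca_hom R[i] (twist C) (twist D) (hlift f).
  exact: (@deformation_is_hdgca_hom _ C D f (ihbar R)).
exists HO, HM; split; first by split=> *; exact: hdgca_homP.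
move=> C D f g /(congr1 (fun h => hdgca_hom_val h))/hlift_inj fg.
by apply: dgca_homP => v; rewrite fg.
Qed.
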